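(* For every integer $n\ge 0$ and every $\tau\in\{213,132,321\}$, $$\sum_{\sigma\in S_n(\tau)}q^{\mathrm{exc}(\sigma)}p^{\mathrm{crs}(\sigma)}=C_n(q,p).$$
   Context: $S_n(\tau)$: permutations of $[n]$ avoiding the pattern $\tau$ ($S_0(\tau)$ contains only the empty permutation). $\mathrm{exc}(\sigma)=|\{i:\sigma(i)>i\}|$; a crossing is a pair $(i,j)$ with $i<j<\sigma(i)<\sigma(j)$ or $\sigma(i)<\sigma(j)\le i<j$, and $\mathrm{crs}(\sigma)$ is their number. The $q,p$-Catalan numbers are defined by $C_0(q,p)=C_1(q,p)=1$ and, for $n\ge2$, $C_n(q,p)=C_{n-1}(q,p)+q\sum_{k=0}^{n-2}p^kC_k(q,p)C_{n-1-k}(q,p)$. *)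

(* Defs.v *)
From mathcomp Require Import all_boot all_algebra all_fingroup.

Set Implicit Arguments.
Unset Strict Implicit.
Unset Printing Implicit Defensive.

Import GRing.Theory.

(* 'S_n permutes 0, ..., n.-1 rather than 1, ..., n; pattern containment,
   excedances and crossings only involve comparisons among positions and
   values, so they are unaffected by this shift. *)

Definition one_line n (s : 'S_n) : seq nat :=
  [seq (s i : nat).+1 | i <- enum 'I_n].

Definition contains k n (tau : 'S_k) (s : 'S_n) : bool :=
  [exists f : {ffun 'I_k -> 'I_n},
    [forall a : 'I_k, forall b : 'I_k,
      ((f a < f b) == (a < b)) && ((s (f a) < s (f b)) == (tau a < tau b))]].

Definition avoiders k n (tau : 'S_k) : {set 'S_n} :=
  [set s : 'S_n | ~~ contains tau s].

Definition exc n (s : 'S_n) : nat := #|[set i : 'I_n | i < s i]|.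

Definition crossing n (s : 'S_n) (i j : 'I_n) : bool :=
  [&& i < j, j < s i & s i < s j] || [&& s i < s j, s j <= i & i < j].

Definition crs n (s : 'S_n) : nat :=
  #|[set ij : 'I_n * 'I_n | crossing s ij.1 ij.2]|.

Section QPCatalan.
Variables (R : comNzRingType) (q p : R).
Local Open Scope ring_scope.

(* The list [:: C_0; ...; C_n]. The step computes C_(m.+1), and for m = 0 its
   sum is empty, which gives C_1 = C_0 = 1. *)
Fixpoint qpCatalan_table (n : nat) : seq R :=
  if n is m.+1 then
    let C := qpCatalan_table m in
    rcons C (C`_m + q * \sum_(k < m) p ^+ k * C`_k * C`_(m - k))
  else [:: 1].

Definition qpCatalan (n : nat) : R := (qpCatalan_table n)`_n.

Lemma size_qpCatalan_table n : size (qpCatalan_table n) = n.+1.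
Proof. by elim: n => //= n IHn; rewrite size_rcons IHn. Qed.

Lemma nth_qpCatalan_table n k :
  (k <= n)%N -> (qpCatalan_table n)`_k = qpCatalan k.
Proof.
elim: n => [|n IHn]; first by rewrite leqn0 => /eqP->.
rewrite leq_eqVlt => /orP[/eqP-> //|]; rewrite ltnS => le_kn /=.
by rewrite nth_rcons size_qpCatalan_table ltnS le_kn IHn.
Qed.

Lemma qpCatalan0 : qpCatalan 0 = 1.
Proof. by []. Qed.

Lemma qpCatalanS n :
  qpCatalan n.+1 = qpCatalan n
    + q * \sum_(k < n) p ^+ k * qpCatalan k * qpCatalan (n - k).
Proof.
rewrite {1}/qpCatalan /= nth_rcons size_qpCatalan_table ltnn eqxx.
congr (_ + q * _); apply: eq_bigr => k _.
by rewrite !nth_qpCatalan_table ?leq_subr // ltnW.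
Qed.

Lemma qpCatalan1 : qpCatalan 1 = 1.
Proof. by rewrite qpCatalanS big_ord0 mulr0 addr0. Qed.

Lemma qpCatalan_rec n : (2 <= n)%N ->
  qpCatalan n = qpCatalan n.-1
    + q * \sum_(0 <= k < n.-1) p ^+ k * qpCatalan k * qpCatalan (n - 1 - k).
Proof. by case: n => // n _; rewrite qpCatalanS big_mkord subn1. Qed.

End QPCatalan.

(* Main.v *)
Require Import Defs.
From mathcomp Require Import all_boot all_algebra all_fingroup.
From mathcomp Require Import zify ring.

(** 321: a word avoids 321 iff every letter is either a new maximum or the
    smallest letter not yet used, and crs is then the sum of s(i) - i - 1 over
    the excedances.  Reading the word from left to right, only the number h of
    pending small letters matters, and the resulting recurrence in h convolves
    to the q,p-Catalan recurrence.

    132: in w = l M r with maximum M, all of l exceeds all of r.  Iterating, w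
    is a noncrossing matching of 2n points (the tunnels of a Dyck path), and the
    excedance and the crossings carried by a letter depend only on the two
    endpoints of its arc.  Deleting the points in pairs from the outside in,
    at both ends at once, turns the weighted matchings into weighted 2-coloured
    Motzkin paths, whose first-passage decomposition is the recurrence.

    213: the reflection in the antidiagonal preserves exc and crs and exchanges
    213 with 132. *)

Set Implicit Arguments.
Unset Strict Implicit.
Unset Printing Implicit Defensive.

Import GRing.Theory.

(** * The recurrences *)

Section Recurrences.
Local Open Scope ring_scope.
Variables (R : comNzRingType) (q p : R).

(** The factor of a letter exceeding its position by [m] in a 321-avoiding word; by truncated
    subtraction non-excedances have [m = 0]. *)
Definition exc_weight m : R := if m is m'.+1 then q * p ^+ m' else 1.

(* N letters remain to be read, h of them smaller than the maximum so far. *)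
Fixpoint stair N h : R :=
  if N is N'.+1 then
    (if h is h'.+1 then stair N' h' else 0)
      + \sum_(h <= m < N'.+1) exc_weight m * stair N' m
  else (h == 0)%N%:R.

Definition stair_tail N h : R := \sum_(h <= m < N) p ^+ m * stair N m.+1.

Lemma stairS0 N : stair N.+1 0%N = stair N 0%N + q * stair_tail N 0%N.
Proof.
rewrite /= add0r big_nat_recl // mul1r mulr_sumr.
by congr (_ + _); apply: eq_bigr => m _; rewrite mulrA.
Qed.

Lemma stairSS N h : stair N.+1 h.+1 = stair N h + q * stair_tail N h.
Proof.
rewrite /= big_add1 mulr_sumr; congr (_ + _).
by apply: eq_bigr => m _; rewrite mulrA.
Qed.

Lemma stair_gt N h : (N < h)%N -> stair N h = 0.
Proof.
elim: N h => [|N IHN] [|h] //=.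
by move=> ltNh; rewrite IHN // big_geq ?addr0 // ltnW.
Qed.

Lemma stair_tailS N h :
  stair_tail N.+1 h
    = \sum_(h <= m < N.+1) p ^+ m * stair N m
      + q * \sum_(h <= m < N.+1) p ^+ m * stair_tail N m.
Proof.
rewrite /stair_tail mulr_sumr -big_split; apply: eq_bigr => m _.
by rewrite stairSS mulrDr mulrCA.
Qed.

Lemma sum_stair_shift N h :
  \sum_(h.+1 <= m < N.+1) p ^+ m * stair N m = p * stair_tail N h.
Proof.
rewrite big_add1 mulr_sumr; apply: eq_bigr => m _.
by rewrite exprS mulrA.
Qed.

(** Induction on [N], expanding one step of [stair] on both sides. The Catalan convolution is the
    case [h = 0], but the expanded tail sums over all heights from [h] on, so [h] stays free. *)
Lemma stair_tailE N h :
  stair_tail N h = \sum_(k < N) p ^+ k * stair k h * stair (N - k) 0%N.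
Proof.
elim: N h => [|N IHN] h; first by rewrite big_ord0 /stair_tail big_geq.
have swap j : \sum_(j <= m < N.+1) p ^+ m * stair_tail N m
    = \sum_(k < N) p ^+ k * stair (N - k) 0%N *
        \sum_(j <= m < N.+1) p ^+ m * stair k m.
  rewrite (eq_bigr (fun m => \sum_(k < N) p ^+ k * stair (N - k) 0%N *
        (p ^+ m * stair k m))); last first.
    by move=> m _; rewrite IHN mulr_sumr; apply: eq_bigr => k _; ring.
  by rewrite exchange_big; apply: eq_bigr => k _; rewrite mulr_sumr.
(* Terms with [m > k] vanish by [stair_gt], so the bound [N] drops to [k] and a shorter tail
   appears. *)
have cut (k : 'I_N) j : \sum_(j.+1 <= m < N.+1) p ^+ m * stair k m
    = p * stair_tail k j.
  rewrite -sum_stair_shift; have [ltjk|lekj] := ltnP j k; last first.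
    rewrite [RHS]big_geq // big_nat_cond big1 // => m; rewrite andbT => /andP[ltjm _].
    by rewrite stair_gt ?mulr0 // (leq_ltn_trans lekj).
  rewrite (@big_cat_nat _ _ _ k.+1) //=; last 2 first.
  - by rewrite ltnS ltnW.
  - by have := ltn_ord k; lia.
  rewrite [X in _ + X]big_nat_cond [X in _ + X]big1 ?addr0 // => m.
  by rewrite andbT => /andP[ltkm _]; rewrite stair_gt ?mulr0.
rewrite big_ord_recl stair_tailS swap subn0 expr0 mul1r.
case: h => [|h].
  rewrite big_nat_recl // expr0 mul1r -(big_add1 _ _ 0 N.+1 xpredT
     (fun m => p ^+ m * stair N m)) sum_stair_shift.
  rewrite (eq_bigr (fun k : 'I_N => p ^+ k * stair k 0%N * stair (N - k) 0%N
     + p ^+ k.+1 * stair_tail k 0%N * stair (N - k) 0%N)); last first.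
    move=> k _; rewrite big_nat_recl // -(big_add1 _ _ 0 N.+1 xpredT
     (fun m => p ^+ m * stair k m)) cut expr0 exprS; ring.
  rewrite big_split -IHN mul1r [LHS]/=.
  rewrite [X in _ = _ + X](eq_bigr (fun k : 'I_N =>
    p * (p ^+ k * stair k 0%N * stair (N - k) 0%N)
    + q * (p ^+ k.+1 * stair_tail k 0%N * stair (N - k) 0%N))); last first.
    by move=> k _; rewrite lift0 subSS stairS0 exprS; ring.
  rewrite big_split -!mulr_sumr -IHN -/(stair N.+1 0%N) stairS0 /=; ring.
rewrite sum_stair_shift mul0r add0r.
rewrite [RHS](eq_bigr (fun k : 'I_N =>
    p * (p ^+ k * stair k h * stair (N - k) 0%N)
    + q * (p ^+ k * stair (N - k) 0%N * (p * stair_tail k h)))); last first.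
  by move=> k _; rewrite lift0 subSS stairSS exprS; ring.
rewrite big_split -!mulr_sumr -IHN /=; congr (_ + q * _).
by apply: eq_bigr => k _; rewrite cut.
Qed.

Lemma stair_qpCatalan n : stair n 0%N = qpCatalan q p n.
Proof.
elim/ltn_ind: n => -[|n] IHn //.
rewrite stairS0 qpCatalanS IHn // stair_tailE; congr (_ + q * _).
by apply: eq_bigr => k _; rewrite !IHn ?ltnS ?leq_subr // ltnW.
Qed.

(* Paths of Z steps from height g to 0, of weight p ^ (sum of the heights after
   each step); the up steps and one of the two kinds of level steps carry q. *)
Fixpoint motzkin Z g : R :=
  if Z is Z'.+1 then
    (1 + q) * p ^+ g * motzkin Z' g + q * p ^+ g.+1 * motzkin Z' g.+1
      + (if g is g'.+1 then p ^+ g' * motzkin Z' g' else 0)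
  else (g == 0)%N%:R.

(** Cut at the first step to height 0, which weighs 1: the [k] steps before it stay above 0, and
    lowering them by one extracts [p ^+ k]. *)
Lemma motzkin_first_passage Z g :
  motzkin Z g.+1 = \sum_(k < Z) p ^+ k * motzkin k g * motzkin (Z - k.+1) 0%N.
Proof.
elim: Z g => [|Z IHZ] g; first by rewrite big_ord0.
rewrite big_ord_recl subn1 expr0 mul1r [LHS]/=.
rewrite [X in _ = _ + X](eq_bigr (fun k : 'I_Z =>
  (1 + q) * p ^+ g.+1 * (p ^+ k * motzkin k g * motzkin (Z - k.+1) 0%N)
  + q * p ^+ g.+2 * (p ^+ k * motzkin k g.+1 * motzkin (Z - k.+1) 0%N)
  + (if g is g'.+1 then p ^+ g *
       (p ^+ k * motzkin k g' * motzkin (Z - k.+1) 0%N) else 0))); last first.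
  by move=> k _; rewrite lift0 subSS /=; case: g => [|g]; rewrite !exprS; ring.
rewrite !big_split -!mulr_sumr -!IHZ /=.
case: g => [|g]; first by rewrite big1 //=; ring.
by rewrite -mulr_sumr -IHZ /= mul0r add0r.
Qed.

(** The first step decides: a level step without [q] gives the term outside the sum, one with [q]
    the summand [k = 0], and an up step with its first passage back to 0 the other summands. *)
Lemma motzkin_qpCatalan n : motzkin n 0%N = qpCatalan q p n.+1.
Proof.
elim/ltn_ind: n => -[|n] IHn; first by rewrite qpCatalan1.
rewrite qpCatalanS big_ord_recl subn0 qpCatalan0 !expr0 !mul1r -IHn // [LHS]/=.
rewrite motzkin_first_passage !expr0 expr1 mulr1 addr0 mulrDl mul1r.
rewrite -addrA mulrDr; congr (_ + (_ + _)).
rewrite -mulrA mulr_sumr; congr (q * _); apply: eq_bigr => k _.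
rewrite lift0 subSS -IHn; last by rewrite ltnS ltnW.
rewrite -[(n - k)%N]prednK ?subn_gt0 // -IHn; last by lia.
by rewrite -subnS exprS !mulrA.
Qed.

End Recurrences.

(** * Permutations as words *)

Definition word n (s : 'S_n) : seq nat := [seq (s i : nat) | i <- enum 'I_n].

Lemma size_word n (s : 'S_n) : size (word s) = n.
Proof. by rewrite size_map size_enum_ord. Qed.

Lemma nth_word n (s : 'S_n) (i : 'I_n) : nth 0 (word s) i = s i.
Proof. by rewrite (nth_map i) ?size_enum_ord // nth_ord_enum. Qed.

Lemma perm_word n : perm_eq [seq word s | s <- enum {: 'S_n}] (permutations (iota 0 n)).
Proof.
have inj : injective (@word n).
  move=> s t eq_st; apply/permP => i; apply: val_inj.
  by rewrite /= -!nth_word eq_st.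
have un : uniq [seq word s | s <- enum {: 'S_n}].
  by rewrite (map_inj_uniq inj) enum_uniq.
have sub : {subset [seq word s | s <- enum {: 'S_n}] <= permutations (iota 0 n)}.
  move=> _ /mapP[s _ ->]; rewrite mem_permutations /word.
  rewrite -val_enum_ord (map_comp val s); apply: perm_map.
  apply: uniq_perm; rewrite ?(map_inj_uniq perm_inj) ?enum_uniq // => i.
  rewrite mem_enum; apply/mapP; exists (s^-1%g i); rewrite ?mem_enum ?permKV //.
have le_size : size (permutations (iota 0 n)) <= size [seq word s | s <- enum {: 'S_n}].
  by rewrite size_permutations ?iota_uniq // size_iota size_map -cardE card_Sn.
have [_ eq_mem] := uniq_min_size un sub le_size.
by apply: uniq_perm eq_mem => //; exact: permutations_uniq.
Qed.

Fixpoint triplewise (T : Type) (P : T -> T -> T -> bool) (w : seq T) :=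
  if w is a :: w' then pairwise (P a) w' && triplewise P w' else true.

Lemma triplewiseP (T : Type) (x0 : T) (P : T -> T -> T -> bool) w :
  reflect (forall i j k, i < j -> j < k -> k < size w ->
             P (nth x0 w i) (nth x0 w j) (nth x0 w k))
          (triplewise P w).
Proof.
elim: w => [|a w IHw] /=; first by apply: ReflectT.
apply: (iffP andP) => [[/(pairwiseP x0) Pa /IHw Pw] [|i] [|j] [|k] //|Paw].
- by move=> _ jk kw; apply: Pa; rewrite ?inE //; apply: (ltn_trans jk kw).
- by move=> ij jk kw; apply: Pw.
split; last by apply/IHw => i j k ij jk kw; apply: (Paw i.+1 j.+1 k.+1).
by apply/(pairwiseP x0) => j k _ kw jk; apply: (Paw 0 j.+1 k.+1).
Qed.

(** Only forward comparisons are tested, so ties count as descents; words of permutations have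
    none. *)
Definition same_order (x y z a b c : nat) :=
  [&& (a < b) == (x < y), (a < c) == (x < z) & (b < c) == (y < z)].

Lemma avoiders_triplewise n (tau : 'S_3) x y z (s : 'S_n) :
  one_line tau = [:: x; y; z] ->
  (s \in avoiders n tau)
    = triplewise (fun a b c => ~~ same_order x y z a b c) (word s).
Proof.
move=> tauE; have tau_lt (a b : 'I_3) :
    (tau a < tau b) = (nth 0 [:: x; y; z] a < nth 0 [:: x; y; z] b).
  have nthE (c : 'I_3) : nth 0 [:: x; y; z] c = (tau c).+1.
    by rewrite -tauE (nth_map ord0) ?size_enum_ord // nth_ord_enum.
  by rewrite !nthE.
have : uniq [:: x; y; z].
  by rewrite -tauE (map_inj_uniq _) ?enum_uniq // => a b [] /val_inj/perm_inj.
rewrite /= !inE negb_or andbT => /andP[/andP[xy xz] yz].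
apply/idP/idP => [av|/(triplewiseP 0) av].
  apply/(triplewiseP 0) => i j k ij jk; rewrite size_word => kn.
  have jn := ltn_trans jk kn; have i_n := ltn_trans ij jn.
  apply: contra av => /and3P[/eqP o1 /eqP o2 /eqP o3].
  have ik := ltn_trans ij jk.
  pose f := [ffun a : 'I_3 => nth (Ordinal i_n) [:: Ordinal i_n; Ordinal jn; Ordinal kn] a].
  rewrite -[i]/(val (Ordinal i_n)) -[j]/(val (Ordinal jn)) -[k]/(val (Ordinal kn)) !nth_word in o1 o2 o3.
  have ne (u v : 'I_n) : u < v -> s u != s v :> nat.
    by move=> uv; rewrite val_eqE (inj_eq perm_inj) -val_eqE neq_ltn uv.
  have := (ne (Ordinal i_n) (Ordinal jn) ij, ne (Ordinal i_n) (Ordinal kn) ik,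
           ne (Ordinal jn) (Ordinal kn) jk).
  move: o1 o2 o3; set A := nat_of_ord (s _); set B := nat_of_ord (s _).
  set C := nat_of_ord (s _) => o1 o2 o3 [[AB AC] BC].
  apply/existsP; exists f; apply/forallP => a; apply/forallP => b.
  rewrite tau_lt !ffunE.
  case: a b => [[|[|[|//]]] ?] [[|[|[|//]]] ?] /=; rewrite -/A -/B -/C ?ltnn //; lia.
apply/existsP => -[f /forallP fP].
have {}fP a b : ((f a < f b) = (a < b))
    * ((s (f a) < s (f b)) = (nth 0 [:: x; y; z] a < nth 0 [:: x; y; z] b)).
  by have /forallP/(_ b)/andP[/eqP-> /eqP->] := fP a; rewrite tau_lt.
pose o2 : 'I_3 := Ordinal (isT : 2 < 3); pose o1 : 'I_3 := Ordinal (isT : 1 < 3).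
have := av (f ord0) (f o1) (f o2); rewrite !fP size_word ltn_ord !nth_word.
by rewrite /same_order !fP !eqxx => /(_ isT isT isT).
Qed.

Lemma sum_words (R : nmodType) n (P : pred (seq nat)) (F : seq nat -> R) :
  (\sum_(s : 'S_n | P (word s)) F (word s)
     = \sum_(w <- permutations (iota 0 n) | P w) F w)%R.
Proof. by rewrite -(perm_big _ (perm_word n)) big_map big_enum_cond. Qed.

Lemma triplewise_wordP n (P : nat -> nat -> nat -> bool) (s : 'S_n) :
  reflect (forall i j k : 'I_n, i < j -> j < k -> P (s i) (s j) (s k))
          (triplewise P (word s)).
Proof.
apply: (iffP (triplewiseP 0 P _)) => [Ps i j k ij jk|Ps i j k ij jk].
  by rewrite -!nth_word; apply: Ps; rewrite ?size_word.
rewrite size_word => kn; have jn := ltn_trans jk kn; have i_n := ltn_trans ij jn.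
have := Ps (Ordinal i_n) (Ordinal jn) (Ordinal kn) ij jk.
by rewrite -!nth_word.
Qed.

(** * Excedances and crossings of a word whose first letter stands at position [o] *)

Fixpoint word_exc o w := if w is a :: w' then (o < a) + word_exc o.+1 w' else 0.

Definition crosses i a j b := (j < a < b) || (a < b <= i).

Fixpoint cross_with i a o w :=
  if w is b :: w' then crosses i a o b + cross_with i a o.+1 w' else 0.

Fixpoint word_crs o w :=
  if w is a :: w' then cross_with o a o.+1 w' + word_crs o.+1 w' else 0.

Lemma word_excE o w : word_exc o w = \sum_(i < size w) (o + i < nth 0 w i).
Proof.
elim: w o => [|a w IHw] o /=; first by rewrite big_ord0.
rewrite big_ord_recl addn0 IHw; congr (_ + _).
by apply: eq_bigr => i _; rewrite lift0 addnS.
Qed.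

Lemma cross_withE i a o w :
  cross_with i a o w = \sum_(j < size w) crosses i a (o + j) (nth 0 w j).
Proof.
elim: w o => [|b w IHw] o /=; first by rewrite big_ord0.
rewrite big_ord_recl addn0 IHw; congr (_ + _).
by apply: eq_bigr => j _; rewrite lift0 addnS.
Qed.

Lemma word_crsE o w :
  word_crs o w = \sum_(i < size w) \sum_(j < size w | i < j)
                    crosses (o + i) (nth 0 w i) (o + j) (nth 0 w j).
Proof.
elim: w o => [|a w IHw] o /=; first by rewrite big_ord0.
rewrite big_ord_recl IHw cross_withE; congr (_ + _).
  rewrite [RHS]big_mkcond big_ord_recl ltnn Monoid.mul1m addn0.
  by apply: eq_bigr => j _; rewrite lift0 addnS.
apply: eq_bigr => i _; rewrite [RHS]big_mkcond big_ord_recl ltn0 Monoid.mul1m big_mkcond.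
by apply: eq_bigr => j _; rewrite !lift0 !addnS.
Qed.

Lemma exc_word n (s : 'S_n) : exc s = word_exc 0 (word s).
Proof.
rewrite word_excE size_word /exc -sum1dep_card big_mkcond.
by apply: eq_bigr => i _; rewrite nth_word add0n; case: ifP.
Qed.

Lemma crs_word n (s : 'S_n) : crs s = word_crs 0 (word s).
Proof.
rewrite word_crsE size_word /crs -sum1dep_card big_mkcond.
rewrite -(pair_bigA _ (fun i j => if crossing s i j then 1 else 0)) /=.
apply: eq_bigr => i _; rewrite [RHS]big_mkcond; apply: eq_bigr => j _.
rewrite !nth_word /crossing /crosses; do 2!case: ifP; lia.
Qed.

(** * The pattern 321 *)

Definition avoids321 := triplewise (fun a b c => ~~ same_order 3 2 1 a b c).

Lemma card_ord_lt n m : m <= n -> #|[set k : 'I_n | k < m]| = m.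
Proof.
move=> le_mn; rewrite -sum1dep_card -(big_ord_widen_cond n xpredT (fun=> 1)) //.
by rewrite sum1_card card_ord.
Qed.

Lemma card_perm_lt n (s : 'S_n) m : m <= n -> #|[set k | s k < m]| = m.
Proof.
move=> le_mn; rewrite -[RHS](card_ord_lt le_mn) -(card_imset _ (@perm_inj _ s)).
apply: eq_card => v; rewrite in_set; apply/imsetP/idP => [[k]|lt_vm].
  by rewrite in_set => ? ->.
by exists (s^-1%g v); rewrite ?in_set permKV.
Qed.

(** The cut after [a] is crossed equally often in both directions, because [A] and [B] have the same
    size and hence so have their differences. *)
Lemma card_perm_crossing n (s : 'S_n) (a : 'I_n) :
  #|[set b : 'I_n | s b <= a < b]| = #|[set i : 'I_n | i <= a < s i]|.
Proof.
pose A := [set k : 'I_n | k < a.+1]; pose B := [set k | s k < a.+1].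
have eqAB : #|A| = #|B| by rewrite card_ord_lt ?card_perm_lt.
have -> : [set b : 'I_n | s b <= a < b] = B :\: A.
  by apply/setP => b; rewrite !inE !ltnS -ltnNge andbC.
have -> : [set i : 'I_n | i <= a < s i] = A :\: B.
  by apply/setP => b; rewrite !inE !ltnS -ltnNge andbC.
have cB := cardsID A B; have cA := cardsID B A.
by rewrite setIC in cB; apply/eqP; rewrite -(eqn_add2l #|A :&: B|) cA cB eqAB.
Qed.

Section Avoid321.
Variables (n : nat) (s : 'S_n).
Hypothesis av : avoids321 (word s).

Lemma no_321 (i j k : 'I_n) : i < j -> j < k -> s j < s i -> s k < s j -> False.
Proof.
move=> ij jk sji skj; have := triplewise_wordP _ _ av i j k ij jk.
by rewrite /same_order; lia.
Qed.

(** If [s i > s a], then all [s a] smaller values must stand left of [a], where there are only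
    [a < s a] places. *)
Lemma exc_incr_321 (i a : 'I_n) : i < a -> a < s a -> s i < s a.
Proof.
move=> ia exc_a; rewrite ltnNge; apply/negP => sai.
have sai' : s a < s i.
  by rewrite ltn_neqAle sai val_eqE (inj_eq perm_inj) -val_eqE neq_ltn ia orbT.
have : #|[set k | s k < s a]| <= #|[set k : 'I_n | k < a]|.
  apply/subset_leq_card/subsetP => k; rewrite !inE => ska.
  case: ltngtP => // [ak|/val_inj ka]; last by rewrite ka ltnn in ska.
  by case: (no_321 ia ak sai' ska).
by rewrite (card_perm_lt s (ltnW (ltn_ord _))) (card_ord_lt (ltnW (ltn_ord a))) leqNgt exc_a.
Qed.

(** If [s b < s a], then [b] and all positions before [a] carry values below [s a], which forces
    [a < s a]. *)
Lemma non_exc_incr_321 (a b : 'I_n) : a < b -> s a <= a -> s a < s b.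
Proof.
move=> ab exc_a; rewrite ltnNge; apply/negP => sba.
have sba' : s b < s a.
  by rewrite ltn_neqAle sba val_eqE (inj_eq perm_inj) -val_eqE neq_ltn ab orbT.
have : #|b |: [set k : 'I_n | k < a]| <= #|[set k | s k < s a]|.
  apply/subset_leq_card/subsetP => k; rewrite !inE => /orP[/eqP-> //|ka].
  case: ltngtP => // [ska|/val_inj/perm_inj ek]; last by rewrite ek ltnn in ka.
  by case: (no_321 ka ab ska sba').
rewrite cardsU1 inE (card_perm_lt s (ltnW (ltn_ord _))) (card_ord_lt (ltnW (ltn_ord a))).
by rewrite ltnNge (ltnW ab) /= add1n ltnNge exc_a.
Qed.

(** Charge upper crossings to their right position and lower ones to their left position. By the two
    monotonicity lemmas, and [card_perm_crossing] for a non-excedance, [a] is charged once for each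
    [i] with [i < a < s i]. *)
Lemma crs_321 : crs s = \sum_(i < n) (s i - i.+1).
Proof.
pose up (i j : 'I_n) := [&& i < j, j < s i & s i < s j]; 
pose dn (i j : 'I_n) := [&& s i < s j, s j <= i & i < j].
have -> : crs s = \sum_a (#|[set i | up i a]| + #|[set b | dn a b]|).
  rewrite big_split /crs -sum1dep_card big_mkcond /=.
  rewrite -(pair_bigA _ (fun i j => if crossing s i j then 1 else 0)) /=.
  rewrite [X in _ = X + _](eq_bigr (fun a => \sum_i up i a)); last first.
    by move=> a _; rewrite -sum1dep_card big_mkcond; apply: eq_bigr => i _; case: ifP.
  rewrite [X in _ = X + _]exchange_big -big_split; apply: eq_bigr => i _ /=.
  rewrite -sum1dep_card [X in _ = _ + X]big_mkcond -big_split; apply: eq_bigr => j _ /=.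
  by rewrite /crossing /up /dn; do 2!case: ifP; lia.
have -> : \sum_(i < n) (s i - i.+1) = \sum_(i < n) #|[set a : 'I_n | i < a < s i]|.
  apply: eq_bigr => i _.
  have -> : [set a : 'I_n | i < a < s i] = [set a : 'I_n | a < s i] :\: [set a : 'I_n | a < i.+1].
    by apply/setP => a; rewrite !inE ltnS -ltnNge.
  have [lt_i|le_i] := ltnP i (s i); last first.
    rewrite (_ : _ :\: _ = set0) ?cards0; first by lia.
    by apply/setP => a; rewrite !inE; lia.
  have sub : [set a : 'I_n | a < i.+1] \subset [set a : 'I_n | a < s i].
    by apply/subsetP => a; rewrite !inE; lia.
  by rewrite cardsD (setIidPr sub) !card_ord_lt // ltnW.
under [RHS]eq_bigr do rewrite -sum1dep_card big_mkcond.
rewrite exchange_big /=; apply: eq_bigr => a _; rewrite -big_mkcond sum1dep_card.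
have [exc_a|exc_a] := ltnP a (s a).
  rewrite [X in _ + X](_ : _ = 0) ?addn0; last first.
    by apply/eqP; rewrite cards_eq0; apply/eqP/setP => b; rewrite !inE /dn; lia.
  congr #|pred_of_set _|; apply/setP => i; rewrite !inE /up; case: ltnP => //= ia.
  by rewrite exc_incr_321 // andbT.
rewrite [X in X + _](_ : _ = 0) ?add0n; last first.
  by apply/eqP; rewrite cards_eq0; apply/eqP/setP => b; rewrite !inE /up; lia.
transitivity #|[set b : 'I_n | s b <= a < b]|.
  congr #|pred_of_set _|; apply/setP => b; rewrite !inE /dn.
  have [ab|] := ltnP a b; last by rewrite !andbF.
  by rewrite non_exc_incr_321.
rewrite card_perm_crossing; congr #|pred_of_set _|; apply/setP => i; rewrite !inE.
case: (ltngtP i a) => // /val_inj ->; lia.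
Qed.

End Avoid321.

(** * Summing over 321-avoiding words letter by letter *)

Section Staircase.
Variables (R : comNzRingType) (q p : R).

Fixpoint stair_weight o (w : seq nat) : R :=
  (if w is a :: w' then exc_weight q p (a - o) * stair_weight o.+1 w' else 1)%R.

Lemma stair_weightE o w :
  (stair_weight o w = \prod_(i < size w) exc_weight q p (nth 0 w i - (o + i)))%R.
Proof.
elim: w o => [|a w IHw] o /=; first by rewrite big_ord0.
rewrite big_ord_recl addn0 IHw; congr (_ * _)%R.
by apply: eq_bigr => i _; rewrite lift0 addnS.
Qed.

Lemma weight_321 n (s : 'S_n) :
  avoids321 (word s) ->
  (q ^+ exc s * p ^+ crs s = stair_weight 0 (word s))%R.
Proof.
move=> av; rewrite (crs_321 av) exc_word word_excE stair_weightE size_word.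
rewrite -!prodrXr -big_split; apply: eq_bigr => i _; rewrite nth_word add0n subnS /=.
by case: ltnP => [|/eqP ->] //; rewrite ?mulr1 // -subn_gt0; case: (s i - i).
Qed.

(* Avoidance of 321 by w preceded by a letter just below m. *)
Definition grows m w :=
  avoids321 w
  && pairwise (fun b c => ~~ (c <= b < m)) w.

(** With the letter before it, [a] and a smaller later letter would form 321; if there is none, [a]
    starts no occurrence. *)
Lemma grows_lt m a w : a < m -> grows m (a :: w) = all (ltn a) w && grows m w.
Proof.
move=> am; rewrite /grows /avoids321 /=.
rewrite (eq_all (a2 := ltn a)); last by move=> c /=; rewrite am andbT ltnNge.
case: (boolP (all (ltn a) w)) => aw; last by rewrite !andbF.
rewrite andTb (_ : pairwise _ w = true) //=.
apply/(pairwiseP 0) => i j iw jw _; have /= := allP aw _ (mem_nth 0 iw).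
by rewrite /same_order; lia.
Qed.

(** Now [a] is a new maximum: the descents it forbids, among letters up to [a], include those below
    [m]. *)
Lemma grows_ge m a w : m <= a -> grows m (a :: w) = grows a.+1 w.
Proof.
move=> ma; rewrite /grows /avoids321 /=.
rewrite (_ : all _ w = true); last by apply/allP => c _; lia.
rewrite andTb [RHS]andbC -andbA andbCA.
have <- : pairwise (fun b c => ~~ same_order 3 2 1 a b c) w
    = pairwise (fun b c => ~~ (c <= b < a.+1)) w.
  by apply: eq_pairwise => b c; rewrite /same_order; lia.
case: (boolP (pairwise _ w)) => [pw|]; rewrite ?andbF //= andbC.
rewrite (_ : pairwise _ w = true) ?andbT //.
by apply: sub_pairwise pw => b c; rewrite /same_order; lia.
Qed.

(** [pend] lists the unread letters below [m]; the equation for [m] says that the other letters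
    below [m] number [o], as many as were read. The next letter is the least of [pend] or a new
    maximum [m + j]. *)
Lemma sum_grows pend l o m : sorted ltn pend -> all (gtn m) pend ->
  m = o + size pend ->
  (\sum_(w <- permutations (pend ++ iota m l) | grows m w) stair_weight o w
     = stair q p (size pend + l) (size pend))%R.
Proof.
have [N] := ubnP (size pend + l); elim: N pend l o m => // N IHN pend l o m.
case Nl: (size pend + l) => [|N'] leN srt ltm mE.
  have [-> ->] : pend = [::] /\ l = 0 by case: pend Nl {leN srt ltm mE} => //=; lia.
  by rewrite big_mkcond big_seq1.
rewrite (perm_big _ (permutationsE _)); last by rewrite size_cat size_iota Nl.
have un : uniq (pend ++ iota m l).
  rewrite cat_uniq iota_uniq (sorted_uniq ltn_trans ltnn srt) andbT /=.
  by apply/hasPn => a; rewrite mem_iota; apply: contraTN => /(allP ltm) /=; lia.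
rewrite big_mkcond big_allpairs_dep (undup_id un) big_cat /=; congr (_ + _)%R.
  case: pend srt ltm mE un Nl => [|a pend] srt ltm mE un Nl; first by rewrite big_nil.
  have am : a < m by case/andP: ltm.
  have ltap : all (ltn a) pend by move: srt => /=; rewrite path_sortedE; [case/andP|exact: ltn_trans].
  have lt_a : all (ltn a) (pend ++ iota m l).
    by rewrite all_cat ltap; apply/allP => b; rewrite mem_iota /=; lia.
  (* The pending letters lie between [a] and [m - 1], so there are at most [m - a] of them: [a] is
     not an excedance and weighs 1. *)
  have ao : a <= o.
    have : size pend <= size (iota a.+1 (m - a.+1)).
      apply: uniq_leq_size; first by move: un; rewrite cat_uniq => /andP[/andP[]].
      move=> b bp; rewrite mem_iota; have /= := allP ltap b bp.
      by case/andP: ltm => _ /allP/(_ _ bp) /=; lia.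
    by move: mE am; rewrite size_iota /=; lia.
  rewrite big_cons [X in (_ + X)%R]big1_seq ?addr0; last first.
    move=> b /= bpend; rewrite big1_seq // => w; rewrite mem_permutations => /= wb.
    rewrite grows_lt; last by case/andP: ltm => _ /allP/(_ _ bpend).
    have ab : a < b := allP ltap b bpend.
    case: allP => // /(_ a); rewrite (perm_mem wb) (ltn_eqF ab) mem_head.
    by move=> /(_ isT) /=; lia.
  rewrite /= eqxx -big_mkcond big_seq_cond /=.
  rewrite (eq_bigl (fun w => (w \in permutations (pend ++ iota m l)) && grows m w)); last first.
    move=> w; case: (boolP (w \in _)) => //=; rewrite mem_permutations => pw.
    by rewrite grows_lt // (perm_all _ pw) lt_a.
  have -> : N' = size pend + l by move: Nl => /= [].
  rewrite -big_seq_cond -(IHN pend l o.+1 m).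
  - by apply: eq_bigr => w _; rewrite (_ : a - o = 0) ?mul1r //; lia.
  - by move: Nl leN => /= [->].
  - exact: path_sorted srt.
  - by case/andP: ltm.
  - by rewrite mE /= addnS.
rewrite -{1}[m]addn0 iotaDl big_map.
rewrite -[X in index_iota X]add0n -Nl big_addn addKn /index_iota subn0.
apply: eq_big_seq => j; rewrite mem_iota add0n => /= jl.
(* The excess of a new maximum over its position is the new number of pending letters. *)
have mj : m + j - o = j + size pend by lia.
pose pend' := pend ++ iota m j; pose l' := l - j.+1.
have remE : perm_eq (rem (m + j) (pend ++ iota m l)) (pend' ++ iota (m + j).+1 l').
  have jin : m + j \in pend ++ iota m l by rewrite mem_cat mem_iota; lia.
  rewrite -(perm_cons (m + j)) -(permPl (perm_to_rem jin)).
  have -> : iota m l = iota m j ++ [:: m + j] ++ iota (m + j).+1 l'.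
    by rewrite {1}(_ : l = j + l'.+1) ?iotaD // /l'; lia.
  by rewrite catA perm_catCA.
rewrite (perm_big _ (perm_permutations remE)) /= mj -big_mkcond.
rewrite (eq_bigl (grows (m + j).+1)); last by move=> w; rewrite grows_ge ?leq_addr.
rewrite -mulr_sumr; congr (_ * _)%R.
have sz : size pend' = j + size pend by rewrite size_cat size_iota addnC.
rewrite IHN ?sz.
- by congr stair; rewrite /l'; lia.
- by rewrite /l'; lia.
- rewrite /pend' (sorted_pairwise ltn_trans) pairwise_cat -!(sorted_pairwise ltn_trans) srt iota_ltn_sorted.
  rewrite !andbT; apply/allrelP => a b /(allP ltm) /=; rewrite mem_iota; lia.
- rewrite /pend' all_cat; apply/andP; split; apply/allP => a; last by rewrite mem_iota /=; lia.
  by move/(allP ltm) => /=; lia.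
- by rewrite mE; lia.
Qed.

End Staircase.

Lemma sum_avoids321 (R : comNzRingType) (q p : R) n :
  (\sum_(s : 'S_n | avoids321 (word s)) q ^+ exc s * p ^+ crs s
     = qpCatalan q p n)%R.
Proof.
rewrite (eq_bigr (fun s => stair_weight q p 0 (word s))); last first.
  by move=> s; exact: weight_321.
rewrite (sum_words n avoids321 (stair_weight q p 0)).
rewrite -stair_qpCatalan -[RHS](@sum_grows _ _ _ [::] n 0 0) //.
apply: eq_bigl => w; rewrite /grows [X in _ && X](_ : _ = true) ?andbT //.
by apply/(pairwiseP 0) => i j _ _ _; rewrite ltn0 andbF.
Qed.

(** * Noncrossing matchings *)

Section Chains.
Local Open Scope ring_scope.
Variables (R : comNzRingType) (w : nat -> nat -> R).

(* The weighted sum over the partial noncrossing matchings of the points s, ...,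
   s + L - 1 in which exactly [size us] points, none of them under an arc, stay
   unmatched: an arc from y to z has weight [w y z], and the i-th unmatched
   point y has weight [us_i y]. *)
Fixpoint chain L s (us : seq (nat -> R)) : R :=
  if L is L'.+1 then
    chain L' s.+1 (w s :: us)
      + (if us is u :: us' then u s * chain L' s.+1 us' else 0)
  else (nilp us)%:R.

(** No arc passes over an unmatched point, so the one with weight [u], preceded by [k] points,
    separates the matching into two independent ones. *)
Lemma chain_cat L s us u us' :
  chain L s (us ++ u :: us')
    = \sum_(k < L) chain k s us * u (s + k)%N * chain (L - k.+1) (s + k).+1 us'.
Proof.
elim: L s us => [|L IHL] s us.
  by rewrite big_ord0; case: us.
rewrite big_ord_recl addn0 subn1 /= -cat_cons IHL.
have e (k : 'I_L) : chain k.+1 s us * u (s + k.+1)%N * chain (L - k.+1) (s + k.+1).+1 us'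
   = chain k s.+1 (w s :: us) * u (s.+1 + k)%N * chain (L - k.+1) (s.+1 + k).+1 us'
   + (if us is v :: us0 then v s * (chain k s.+1 us0 * u (s.+1 + k)%N * chain (L - k.+1) (s.+1 + k).+1 us') else 0).
  by rewrite addnS addSn /=; case: us => [|v us0]; ring.
rewrite [X in _ = _ + X](eq_bigr _ (fun k _ => e k)) big_split /= [RHS]addrC -addrA.
congr (_ + _); case: us e => [|v us0] _; last by rewrite /= mul0r mul0r addr0 IHL mulr_sumr.
by rewrite big1 //= mul1r add0r.
Qed.

Lemma chain_odd L s us : odd (L + size us) -> chain L s us = 0.
Proof.
elim: L s us => [|L IHL] s us; first by case: us.
rewrite addSn => /= oddL.
rewrite IHL ?addnS // add0r; case: us oddL => [|u us] //=.
by rewrite addnS negbK => /IHL->; rewrite mulr0.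
Qed.

(* [chain] deletes the leftmost point, this lemma the rightmost one. *)
Lemma chain_recr L s :
  chain L.+1 s [::] = chain L s [:: fun y => w y (s + L)%N]
  /\ forall us u, chain L.+1 s (rcons us u)
       = chain L s (rcons (rcons us u) (fun y => w y (s + L)%N))
         + chain L s us * u (s + L)%N.
Proof.
elim: L s => [|L IHL] s.
  split=> [|us u]; rewrite /= ?addr0 // addn0.
  by case: us => [|v [|v' us]] /=;
    rewrite !(mulr1, mul1r, mulr0, mul0r, add0r, addr0).
have [step0 step] := IHL s.+1; rewrite addSnnS in step0 step.
split=> [|us u]; first by rewrite /= !addr0 -/(chain L.+1 _ _) (step [::]) /= mulrC.
case: us => [|v us]; rewrite [LHS]/= -!/(chain L.+1 _ _).
  by rewrite (step [:: w s]) step0 /= !addr0; ring.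
by rewrite -rcons_cons -rcons_cons (step (w s :: v :: us)) step /=; ring.
Qed.

(** Each end point either has an arc or is unmatched; with one unmatched point in all, three of the
    four cases remain. *)
Lemma chain_peel1 L s a :
  chain L.+2 s [:: a]
    = chain L s.+1 [:: w s; a; fun y => w y (s + L.+1)%N]
      + chain L s.+1 [:: w s] * a (s + L.+1)%N
      + a s * chain L s.+1 [:: fun y => w y (s + L.+1)%N].
Proof.
have [step0 step] := chain_recr L s.+1; rewrite addSnnS in step0 step.
by rewrite [LHS]/= -!/(chain L.+1 _ _) (step [:: w s]) step0.
Qed.

Lemma chain_peel L s a us b :
  chain L.+2 s (a :: rcons us b)
    = chain L s.+1 (rcons (w s :: a :: rcons us b) (fun y => w y (s + L.+1)%N))
      + chain L s.+1 (w s :: a :: us) * b (s + L.+1)%N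
      + a s * (chain L s.+1 (rcons (rcons us b) (fun y => w y (s + L.+1)%N))
               + chain L s.+1 us * b (s + L.+1)%N).
Proof.
have [_ step] := chain_recr L s.+1; rewrite addSnnS in step.
by rewrite [LHS]/= -!/(chain L.+1 _ _) (step (w s :: a :: us)) step.
Qed.

Inductive rescaled (s L : nat) : R -> seq (nat -> R) -> seq (nat -> R) -> Prop :=
| Rescaled_nil : rescaled s L 1 [::] [::]
| Rescaled_cons c d u v us vs :
    (forall y, (s <= y < s + L)%N -> u y = c * v y) ->
    rescaled s L d us vs -> rescaled s L (c * d) (u :: us) (v :: vs).

(** [chain] is linear in each weight of the list and evaluates it only at the points [s], ...,
    [s + L - 1]. *)
Lemma chain_rescaled L s c us vs :
  rescaled s L c us vs -> chain L s us = c * chain L s vs.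
Proof.
have shift s' L' c' us' vs' :
    rescaled s' L'.+1 c' us' vs' -> rescaled s'.+1 L' c' us' vs'.
  elim=> [|d e u v us'' vs'' uv _ IH]; first exact: Rescaled_nil.
  by apply: Rescaled_cons => // y ?; apply: uv; lia.
elim: L s c us vs => [|L IHL] s c us vs sc.
  by case: sc => [|? ? ? ? ? ? _ _]; rewrite /= ?mulr0 ?mulr1.
have -> : chain L.+1 s us = c * chain L s.+1 (w s :: vs)
    + (if us is u :: us' then u s * chain L s.+1 us' else 0).
  rewrite /= (IHL _ (1 * c) _ (w s :: vs)); first by rewrite mul1r.
  by apply: Rescaled_cons (shift _ _ _ _ _ sc) => y _; rewrite mul1r.
case: sc => [|d e u v us' vs' uv sc]; first by rewrite /= !addr0.
rewrite (IHL _ _ _ _ (shift _ _ _ _ _ sc)) uv /=; first by ring.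
by rewrite leqnn addnS ltnS leq_addr.
Qed.

Lemma rescaled_rcons s L c d us vs u v :
  rescaled s L d us vs -> (forall y, (s <= y < s + L)%N -> u y = c * v y) ->
  rescaled s L (d * c) (rcons us u) (rcons vs v).
Proof.
move=> sc uv; elim: sc => [|d' e u' v' us' vs' uv' _ IH] /=.
  by rewrite mulrC; apply: Rescaled_cons => //; exact: Rescaled_nil.
by rewrite -mulrA; apply: Rescaled_cons.
Qed.

(** The [2g + 1] entries alternate because successive unmatched points enclose an even number of
    matched ones and so alternate in parity. *)
Fixpoint alternate (a b : nat -> R) g :=
  if g is g'.+1 then a :: b :: alternate a b g' else [:: a].

Lemma alternateS a b g : alternate a b g.+1 = a :: rcons (alternate b a g) a.
Proof. by elim: g => //= g ->. Qed.

Lemma alternate_rcons a b g :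
  alternate a b g.+1 = rcons (rcons (alternate a b g) b) a.
Proof. by elim: g => //= g ->. Qed.

Lemma rescaled_alternate s L c a b b' g :
  (forall y, (s <= y < s + L)%N -> b y = c * b' y) ->
  rescaled s L (c ^+ g) (alternate a b g) (alternate a b' g).
Proof.
move=> bb'; have aa y : (s <= y < s + L)%N -> a y = 1 * a y by rewrite mul1r.
elim: g => [|g IHg] /=.
  by rewrite expr0 -[1]mulr1; apply: Rescaled_cons => //; exact: Rescaled_nil.
by rewrite exprS -[_ * _]mul1r; do 2![apply: Rescaled_cons => //].
Qed.

End Chains.

(** * Weighted matchings as Motzkin paths *)

Section Tunnels.
Local Open Scope ring_scope.
Variables (R : comNzRingType) (q p : R) (N : nat).

Definition depth y := minn y (N.*2 - y).

(* The points are 1, ..., 2N; the endpoint of smaller depth is met first by the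
   outside-in deletion. An arc encloses an even number of points, so only those
   with y + z odd occur; giving the others weight 0 here and in [exposed] keeps
   the exponents of p integral. *)
Definition arc_weight y z : R :=
  if ~~ odd (y + z) then 0
  else if (y + z < N.*2)%N then q * p ^+ ((depth z - depth y).-1)./2
  else p ^+ ((depth y - depth z).-1)./2.

(** As a function of the remaining end [y], the weight without [q] of an arc whose other end, of
    depth [j.-1], is deleted. *)
Definition exposed j y : R :=
  if odd (depth y + j) then 0 else p ^+ (depth y - j)./2.

Lemma exposed_id j : (j <= N)%N -> exposed j j = 1.
Proof.
move=> le_jN; have -> : exposed j j = if odd (j + j) then 0 else p ^+ (j - j)./2.
  by rewrite /exposed (_ : depth j = j) // /depth; lia.
by rewrite addnn odd_double subnn.
Qed.

Lemma exposedSS j y : (j < depth y)%N -> exposed j y = p * exposed j.+2 y.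
Proof.
rewrite /exposed => lty; rewrite !addnS /= negbK.
case: ifPn => [|ev]; first by rewrite mulr0.
by rewrite -exprS; congr (_ ^+ _); lia.
Qed.

Lemma arc_weight_left j y : (j < y < N.*2 - j)%N -> arc_weight j y = q * exposed j.+1 y.
Proof.
move=> ineq; have jy : (j + y < N.*2)%N by lia.
have -> : arc_weight j y = if ~~ odd (j + y) then 0 else
  q * p ^+ ((depth y - depth j).-1)./2 by rewrite /arc_weight jy.
rewrite /exposed /depth; case: ifPn => ev1; case: ifPn => ev2; rewrite ?mulr0 //.
- by exfalso; lia.
- by exfalso; lia.
by congr (_ * _ ^+ _); lia.
Qed.

Lemma arc_weight_right j y :
  (j < y < N.*2 - j)%N -> arc_weight y (N.*2 - j) = exposed j.+1 y.
Proof.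
move=> ineq; have jy : (y + (N.*2 - j) < N.*2)%N = false by lia.
rewrite /arc_weight jy /exposed /depth; case: ifPn => ev1; case: ifPn => ev2 //.
- by exfalso; lia.
- by exfalso; lia.
by congr (_ ^+ _); lia.
Qed.

(** Height [g] means [2g + 1] unmatched points. Deleting [j] and [N.*2 - j] is one step: up if both
    have arcs, level if one has, down if none; an arc at [j] brings the [q]. Each surviving
    [exposed j] releases a [p], and the survivors are as many as the new height. *)
Lemma chain_motzkin Z j g : (j + Z)%N = N ->
  chain arc_weight Z.*2.+1 j (alternate (exposed j) (exposed j.+1) g) = motzkin q p Z g.
Proof.
elim: Z j g => [|Z IHZ] j g jZ.
  rewrite addn0 in jZ; case: g => [|g]; rewrite /= ?add0r ?mulr0 // mulr1.
  by rewrite exposed_id // jZ.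
have {}IHZ g' : chain arc_weight Z.*2.+1 j.+1 (alternate (exposed j.+1) (exposed j.+2) g')
    = motzkin q p Z g' by apply: IHZ; lia.
have e : (j + Z.*2.+2 = N.*2 - j)%N by lia.
(* Both ends have depth [j], so an unmatched end weighs 1. *)
have e1 : exposed j j = 1 by rewrite exposed_id //; lia.
have e2 : exposed j (N.*2 - j) = 1.
  by rewrite -e1 /exposed (_ : depth (N.*2 - j) = depth j) // /depth; lia.
have inside y : (j.+1 <= y < j.+1 + Z.*2.+1)%N -> (j < y < N.*2 - j)%N by lia.
have scL y : (j.+1 <= y < j.+1 + Z.*2.+1)%N -> arc_weight j y = q * exposed j.+1 y.
  by move/inside/arc_weight_left.
have scR y : (j.+1 <= y < j.+1 + Z.*2.+1)%N -> arc_weight y (N.*2 - j) = 1 * exposed j.+1 y.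
  by move/inside/arc_weight_right; rewrite mul1r.
have scM y : (j.+1 <= y < j.+1 + Z.*2.+1)%N -> exposed j y = p * exposed j.+2 y.
  by move=> ?; apply: exposedSS; rewrite /depth; lia.
have alt g' := rescaled_alternate (exposed j.+1) g' scM.
rewrite doubleS; case: g => [|g].
  rewrite chain_peel1 e e1 e2.
  rewrite (@chain_rescaled _ _ _ _ (q * (p * (1 * 1))) _
    (alternate (exposed j.+1) (exposed j.+2) 1)); last first.
    by do 3![apply: Rescaled_cons => //]; exact: Rescaled_nil.
  rewrite (@chain_rescaled _ _ _ _ (q * 1) [:: arc_weight j]
    (alternate (exposed j.+1) (exposed j.+2) 0)); last first.
    by apply: Rescaled_cons => //; exact: Rescaled_nil.
  rewrite (@chain_rescaled _ _ _ _ (1 * 1) [:: fun y => arc_weight y (N.*2 - j)%N]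
    (alternate (exposed j.+1) (exposed j.+2) 0)); last first.
    by apply: Rescaled_cons => //; exact: Rescaled_nil.
  by rewrite !IHZ /=; ring.
rewrite alternateS chain_peel e e1 e2.
(* The four terms are, in order, the up step, the level steps with and without [q], and the down
   step. *)
rewrite (@chain_rescaled _ _ _ _ (q * (p * (p ^+ g * p)) * 1) _
  (alternate (exposed j.+1) (exposed j.+2) g.+2)); last first.
  rewrite alternate_rcons; apply: rescaled_rcons scR.
  by do 2![apply: Rescaled_cons => //]; exact: rescaled_rcons.
rewrite (@chain_rescaled _ _ _ _ (q * (p * p ^+ g)) (arc_weight j :: _)
  (alternate (exposed j.+1) (exposed j.+2) g.+1)); last first.
  by do 2![apply: Rescaled_cons => //].
rewrite (@chain_rescaled _ _ _ _ (p ^+ g * p * 1) (rcons _ _)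
  (alternate (exposed j.+1) (exposed j.+2) g.+1)); last first.
  by rewrite alternate_rcons; do 2![apply: rescaled_rcons => //].
rewrite (chain_rescaled _ (alt g)) !IHZ /= !exprS; ring.
Qed.

(** The point [N.*2] has depth 0 and no mirror image among the points. Deleting it alone leaves a
    set symmetric about [N] with one unmatched point, that is height 0. *)
Lemma chain_qpCatalan : chain arc_weight N.*2 1 [::] = qpCatalan q p N.
Proof.
case: (posnP N) => [->|N_gt0]; first by rewrite qpCatalan0.
rewrite -[in RHS](prednK N_gt0) -motzkin_qpCatalan.
rewrite -(@chain_motzkin _ 1) ?add1n ?prednK //.
have -> : N.*2 = N.-1.*2.+2 by lia.
rewrite (chain_recr _ _ _).1.
rewrite (@chain_rescaled _ _ _ _ (1 * 1) _ (alternate (exposed 1) (exposed 2) 0)).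
  by rewrite !mul1r.
apply: Rescaled_cons => [y ?|]; last exact: Rescaled_nil.
rewrite mul1r -arc_weight_right; last by lia.
by congr arc_weight; lia.
Qed.

End Tunnels.

(** * The pattern 132 *)

(** Sorting [r] and [l] separately gives a sorted concatenation, which must be the interval
    itself. *)
Lemma perm_iota_split l r v n : perm_eq (l ++ r) (iota v n) ->
  allrel (fun a b => b < a) l r ->
  perm_eq r (iota v (size r)) /\ perm_eq l (iota (v + size r) (size l)).
Proof.
move=> lr gt_lr.
have ls := perm_size lr; rewrite size_cat size_iota in ls.
have : sort leq r ++ sort leq l = iota v n.
  apply: (sorted_eq leq_trans anti_leq); last 2 first.
  - exact: iota_sorted.
  - rewrite perm_catC; apply: perm_trans lr.
    by apply: perm_cat; rewrite perm_sort.
  rewrite (sorted_pairwise leq_trans) pairwise_cat.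
  rewrite -!(sorted_pairwise leq_trans) !sort_sorted ?andbT; try exact: leq_total.
  by apply/allrelP => b a; rewrite !mem_sort => rb la; apply/ltnW/(allrelP gt_lr).
rewrite -ls addnC iotaD => /eqP; rewrite eqseq_cat ?size_sort ?size_iota //.
by case/andP=> /eqP <- /eqP <-; split; rewrite perm_sym perm_sort.
Qed.

Lemma count_gt_iota j v k : count (ltn j) (iota v k) = minn k (v + k - j.+1).
Proof. by elim: k v => [|k IHk] v /=; rewrite ?IHk; lia. Qed.

Definition avoids132 := triplewise (fun a b c => ~~ same_order 1 3 2 a b c).

(** An occurrence starts with its least letter, so one starting in [l] misses [r] and could use [M]
    only last, where no largest letter stands; [M] starts none. *)
Lemma avoids132_cat l M r : all (gtn M) l -> all (gtn M) r ->
  allrel (fun a b => b < a) l r ->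
  avoids132 (l ++ M :: r) = avoids132 l && avoids132 r.
Proof.
move=> + rM; elim: l => [_ _|a l IHl] /=.
  rewrite /avoids132 /= (_ : pairwise _ r = true) //.
  apply/(pairwiseP 0) => i j ir jr _; have /= := allP rM _ (mem_nth 0 ir).
  by rewrite /same_order; lia.
case/andP=> aM lM; rewrite allrel_consl => /andP[ra rl].
rewrite /avoids132 /= -!/avoids132 IHl // andbA; congr (_ && _ && _).
rewrite pairwise_cat [X in [&& X, _ & _]](_ : _ = true); last first.
  apply/allrelP => b c bl; rewrite inE /same_order => /orP[/eqP->|cr].
    by have /= := allP lM _ bl; lia.
  by have /= := allP ra _ cr; lia.
rewrite [X in [&& _, _ & X]](_ : _ = true) ?andbT //=.
apply/andP; split; first by apply/allP => c cr; have /= := allP ra _ cr; rewrite /same_order; lia.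
apply/(pairwiseP 0) => i j ir jr _; have /= := allP ra _ (mem_nth 0 jr).
by rewrite /same_order; lia.
Qed.

(** A letter of [l] below one of [r] would form 132 with [M] between them. *)
Lemma avoids132_split l M r : all (gtn M) r -> uniq (l ++ M :: r) ->
  avoids132 (l ++ M :: r) -> allrel (fun a b => b < a) l r.
Proof.
move=> rM; elim: l => [|a l IHl] //= /andP[]; rewrite mem_cat inE !negb_or.
move=> /and3P[_ aM ar] un; rewrite /avoids132 /= => /andP[pw av].
rewrite allrel_consl IHl // andbT; apply/allP => b br /=.
move: pw; rewrite pairwise_cat => /and3P[_ _ /=/andP[/allP/(_ b br)]] /=.
have /= := allP rM _ br; have : a != b by apply: contraNneq ar => ->.
by rewrite /same_order; lia.
Qed.

Lemma word_exc_cat o l r :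
  word_exc o (l ++ r) = word_exc o l + word_exc (o + size l) r.
Proof.
by elim: l o => [|a l IHl] o /=; rewrite ?addn0 // IHl addnA addSnnS.
Qed.

Lemma cross_with_cat i a o l r :
  cross_with i a o (l ++ r)
    = cross_with i a o l + cross_with i a (o + size l) r.
Proof.
by elim: l o => [|b l IHl] o /=; rewrite ?addn0 // IHl addnA addSnnS.
Qed.

Lemma cross_with_gt i a o r : all (fun b => b <= a) r -> cross_with i a o r = 0.
Proof.
by elim: r o => //= b r IHr o /andP[ba /IHr->]; rewrite /crosses; lia.
Qed.

Fixpoint cross_from o l j b :=
  if l is a :: l' then crosses o a j b + cross_from o.+1 l' j b else 0.

(** A crossing is always an ascent, so [r] crosses nothing to its left. *)
Lemma word_crs_cat o l M r : all (gtn M) r -> allrel (fun a b => b < a) l r ->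
  word_crs o (l ++ M :: r)
    = word_crs o l + cross_from o l (o + size l) M + word_crs (o + size l).+1 r.
Proof.
move=> rM; elim: l o => [|a l IHl] o /=.
  rewrite !addn0 !add0n (@cross_with_gt _ _ _ r) //.
  apply/allP => b br.
  exact: ltnW (allP rM b br).
rewrite allrel_consl => /andP[ra rl]; rewrite cross_with_cat /= IHl //.
rewrite (@cross_with_gt _ _ _ r); last by apply: sub_all ra => b; exact: ltnW.
by rewrite addSnnS; lia.
Qed.

(** An excedance [M] has only upper crossings with [l], namely with the letters above its
    position. *)
Lemma cross_from_lt o l j M : all (gtn M) l -> o + size l <= j -> j < M ->
  cross_from o l j M = count (ltn j) l.
Proof.
elim: l o => //= a l IHl o /andP[aM lM] lj jM.
by rewrite IHl // ?addSnnS // /crosses; congr (_ + _); lia.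
Qed.

(** Here only lower crossings occur, with the letters at positions from [M] on. *)
Lemma cross_from_ge o l j M : all (gtn M) l -> M <= j ->
  cross_from o l j M = minn (size l) (o + size l - M).
Proof.
elim: l o => [|a l IHl] o /=; first by rewrite min0n.
by move=> /andP[aM lM] jM; rewrite IHl // /crosses; lia.
Qed.

(** * Decomposing 132-avoiding words at the maximum *)

Section Tunnels132.
Variables (R : comNzRingType) (q p : R).
Local Open Scope ring_scope.

Definition word_weight o w : R := q ^+ word_exc o w * p ^+ word_crs o w.

(* The contribution of a letter M at position i preceded by the k letters just
   below it: its excedance, and its crossings with these k letters. *)
Definition tunnel_weight k i M : R :=
  if (i < M)%N then q * p ^+ minn k (M - i.+1) else p ^+ minn k (i - M).

Lemma word_weight_cat o l M r k :
  perm_eq l (iota (M - k) k) -> (k <= M)%N -> all (gtn M) r ->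
  allrel (fun a b => b < a)%N l r ->
  word_weight o (l ++ M :: r)
    = tunnel_weight k (o + k) M * word_weight o l * word_weight (o + k).+1 r.
Proof.
move=> pl kM rM lr; have sl : size l = k by rewrite (perm_size pl) size_iota.
have lM : all (gtn M) l.
  by rewrite (perm_all _ pl); apply/allP => a; rewrite mem_iota /=; lia.
rewrite /word_weight word_exc_cat word_crs_cat // sl /= /tunnel_weight.
case: ltnP => jM.
  rewrite cross_from_lt ?sl // (seq.permP pl) count_gt_iota subnK // !exprD expr1; ring.
by rewrite cross_from_ge // sl !exprD expr0; ring.
Qed.

Definition sum132 n o v : R :=
  \sum_(w <- permutations (iota v n) | avoids132 w) word_weight o w.

Lemma sum132S n o v :
  sum132 n.+1 o v = \sum_(k < n.+1) tunnel_weight k (o + k) (v + n)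
     * sum132 k o (v + (n - k)) * sum132 (n - k) (o + k).+1 v.
Proof.
pose M := (v + n)%N.
have iE : iota v n.+1 = iota v n ++ [:: M] by rewrite -addn1 iotaD.
(* [M] occurs in every word, so its index is at most [n] and [inord] keeps it. *)
rewrite /sum132 (partition_big (fun w => inord (index M w) : 'I_n.+1) xpredT) //.
apply: eq_bigr => k _.
pose A n v := [seq w <- permutations (iota v n) | avoids132 w].
have memA w m u : (w \in A m u) = avoids132 w && perm_eq w (iota u m).
  by rewrite mem_filter mem_permutations.
have kn : (k <= n)%N by rewrite -ltnS.
rewrite -big_filter (@perm_big _ _ _ _ _
  [seq l ++ M :: r | l <- A k (v + (n - k))%N, r <- A (n - k)%N v]); last first.
  apply: uniq_perm => [||w].
  - by rewrite filter_uniq ?permutations_uniq.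
  - apply: allpairs_uniq; try by rewrite filter_uniq ?permutations_uniq.
    move=> [l r] [l' r'] /allpairsP[[l1 r1] /= [l1A _ [-> _]]].
    move=> /allpairsP[[l2 r2] /= [l2A _ [-> _]]] /eqP.
    rewrite !memA in l1A l2A.
    have /andP[_ /perm_size s1] := l1A; have /andP[_ /perm_size s2] := l2A.
    by rewrite eqseq_cat ?s1 ?s2 //= eqseq_cons eqxx /= => /andP[/eqP-> /eqP->].
  rewrite mem_filter mem_permutations; apply/idP/allpairsP => [|[[l r]]].
    case/andP=> /andP[av /eqP ik] pw.
    have Mw : M \in w by rewrite (perm_mem pw) mem_iota /M; lia.
    have unw : uniq w by rewrite (perm_uniq pw) iota_uniq.
    have szw : size w = n.+1 by rewrite (perm_size pw) size_iota.
    have iM : index M w = k.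
      by rewrite -ik inordK // -szw index_mem.
    have wE : w = take k w ++ M :: drop k.+1 w.
      by rewrite -iM -{2}(nth_index 0%N Mw) -drop_nth ?index_mem ?cat_take_drop.
    set l := take k w in wE; set r := drop k.+1 w in wE.
    have sl : size l = k by rewrite size_take szw ltnS kn.
    have sr : size r = (n - k)%N by rewrite size_drop szw subSS.
    have plr : perm_eq (l ++ r) (iota v n).
      rewrite -(perm_cons M) -[M :: (l ++ r)]/([:: M] ++ l ++ r) perm_catCA -wE.
      by rewrite (permPl pw) iE perm_catC.
    have lrM a : a \in l ++ r -> (a < M)%N.
      by rewrite (perm_mem plr) mem_iota /M; lia.
    have rM : all (gtn M) r by apply/allP => a ar; apply: lrM; rewrite mem_cat ar orbT.
    have lM : all (gtn M) l by apply/allP => a al; apply: lrM; rewrite mem_cat al.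
    have gt_lr : allrel (fun a b => b < a)%N l r.
      by apply: (avoids132_split rM); rewrite -wE.
    have [pr pl] := perm_iota_split plr gt_lr.
    exists (l, r); rewrite !memA /=; split=> //.
    - by move: pl; rewrite sl sr => ->; move: av; rewrite wE avoids132_cat // => /andP[->].
    - by move: pr; rewrite sr => ->; move: av; rewrite wE avoids132_cat // => /andP[_ ->].
  rewrite !memA /= => -[/andP[avl pl] /andP[avr pr] ->].
  have sl : size l = k by rewrite (perm_size pl) size_iota.
  have lM : all (gtn M) l.
    by rewrite (perm_all _ pl); apply/allP => a; rewrite mem_iota /M /=; lia.
  have rM : all (gtn M) r.
    by rewrite (perm_all _ pr); apply/allP => a; rewrite mem_iota /M /=; lia.
  have gt_lr : allrel (fun a b => b < a)%N l r.
    by apply/allrelP => a b; rewrite (perm_mem pl) (perm_mem pr) !mem_iota; lia.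
  rewrite avoids132_cat // avl avr; apply/andP; split.
    have Ml : M \notin l by apply/negP => /(allP lM) /=; rewrite ltnn.
    by rewrite index_cat (negPf Ml) /= eqxx addn0 sl inord_val.
  rewrite -/(iota v n.+1) iE perm_sym perm_catC -[M :: r]cat1s perm_sym perm_catCA perm_cat2l perm_catC.
  have -> : iota v n = iota v (n - k) ++ iota (v + (n - k)) k by rewrite -iotaD subnK.
  exact: perm_cat.
rewrite big_allpairs_dep !big_filter [X in _ = X * _]mulr_sumr mulr_suml.
rewrite big_seq_cond [RHS]big_seq_cond; apply: eq_bigr => l; rewrite mem_permutations => /andP[pl _].
rewrite big_filter mulr_sumr big_seq_cond [RHS]big_seq_cond; apply: eq_bigr => r.
rewrite mem_permutations => /andP[pr _].
have Mk : (M - k = v + (n - k))%N by rewrite /M; lia.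
rewrite (@word_weight_cat _ _ _ _ k) //.
- by rewrite Mk.
- by rewrite /M; lia.
- by rewrite (perm_all _ pr); apply/allP => a; rewrite mem_iota /M /=; lia.
by apply/allrelP => a b; rewrite (perm_mem pl) (perm_mem pr) !mem_iota; lia.
Qed.

Lemma sum_even_terms n (F : nat -> R) : (forall k, odd k -> F k = 0) ->
  \sum_(k < n.*2.+1) F k = \sum_(k < n.+1) F k.*2.
Proof.
move=> F_odd; elim: n => [|n IHn]; first by rewrite !big_ord1.
rewrite doubleS big_ord_recr big_ord_recr /= IHn F_odd ?addr0; last by lia.
by rewrite [RHS]big_ord_recr.
Qed.

(** For [M = v + n] at position [i = o + k] the endpoints add up to [2N + 2(i - M) + 1], which is
    below [2N] exactly for an excedance; the minimum in the exponent tells whether both endpoints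
    lie in the same half. *)
Lemma tunnel_weight_arc N n k o v : (k <= n)%N -> (v + n < N)%N -> (o + n < N)%N ->
  tunnel_weight k (o + k) (v + n)
    = arc_weight q p N (N + o - (v + n)) (N + o - (v + n) + k.*2.+1)%N.
Proof.
move=> kn vN oN; rewrite /tunnel_weight /arc_weight /depth.
set y := (N + o - (v + n))%N; have -> : ~~ odd (y + (y + k.*2.+1)) = false by lia.
have -> : (y + (y + k.*2.+1) < N.*2)%N = (o + k < v + n)%N by rewrite /y; lia.
case: ifP => iM; first by congr (_ * _ ^+ _); rewrite /y; lia.
by congr (_ ^+ _); rewrite /y; lia.
Qed.

(* A word at positions o, ..., on the values v, ..., v + n - 1 occupies the 2n
   points starting at N + o + 1 - (v + n). *)
Lemma sum132_chain N n o v : (v + n <= N)%N -> (o + n <= N)%N ->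
  sum132 n o v = chain (arc_weight q p N) n.*2 (N + o.+1 - (v + n)) [::].
Proof.
elim/ltn_ind: n o v => -[|n] IHn o v vN oN.
  by rewrite /sum132 big_mkcond big_seq1 /word_weight /= !expr0 mulr1.
set w := arc_weight q p N.
have -> : (N + o.+1 - (v + n.+1) = N + o - (v + n))%N by lia.
set y := (N + o - (v + n))%N.
rewrite doubleS [RHS]/= -/(chain w n.*2.+1 _ _) addr0 -(cat0s [:: _]) chain_cat.
pose F k := chain w k y.+1 [::] * w y (y.+1 + k)%N
  * chain w (n.*2.+1 - k.+1) (y.+1 + k).+1 [::].
(* The arc from [y] encloses an even number of points, twice the length of the word left of the
   maximum. *)
rewrite -[RHS]/(\sum_(k < n.*2.+1) F k) sum_even_terms; last first.
  by move=> k k_odd; rewrite /F chain_odd ?addn0 // !mul0r.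
rewrite sum132S; apply: eq_bigr => k _; have kn : (k <= n)%N by rewrite -ltnS.
rewrite (tunnel_weight_arc (N := N)) //; try by lia.
rewrite !IHn /F -/w -/y; try lia.
rewrite [X in _ = X * _]mulrC.
have -> : (n.*2.+1 - k.*2.+1 = (n - k).*2)%N by lia.
congr (w y _ * chain w _ _ _ * chain w _ _ _); rewrite /y; lia.
Qed.

End Tunnels132.

Lemma sum_avoids132 (R : comNzRingType) (q p : R) n :
  (\sum_(s : 'S_n | avoids132 (word s)) q ^+ exc s * p ^+ crs s
     = qpCatalan q p n)%R.
Proof.
rewrite (eq_bigr (fun s => word_weight q p 0 (word s))); last first.
  by move=> s _; rewrite exc_word crs_word.
rewrite (sum_words n avoids132 (word_weight q p 0)).
rewrite -/(sum132 q p n 0 0) (@sum132_chain _ _ _ n) //.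
by rewrite addn1 add0n subSnn chain_qpCatalan.
Qed.

(** * The pattern 213 *)

Section Antidiagonal.
Variable n : nat.
Implicit Types s : 'S_n.

Definition antiflip s : 'S_n :=
  perm (inj_comp rev_ord_inj (inj_comp (@perm_inj _ s^-1%g) rev_ord_inj)).

Lemma antiflipE s i : antiflip s (rev_ord (s i)) = rev_ord i.
Proof. by rewrite permE /= rev_ordK permK. Qed.

Lemma antiflipK : involutive antiflip.
Proof.
move=> s; apply/permP => i.
by have := antiflipE (antiflip s) (rev_ord (s i)); rewrite (antiflipE s) !rev_ordK.
Qed.

Lemma rev_ord_perm_inj s : injective (fun i => rev_ord (s i)).
Proof. exact: inj_comp rev_ord_inj (@perm_inj _ s). Qed.

Lemma ltn_rev_ord (i j : 'I_n) : (rev_ord i < rev_ord j) = (j < i).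
Proof. by rewrite /= ltn_sub2lE. Qed.

Lemma leq_rev_ord (i j : 'I_n) : (rev_ord i <= rev_ord j) = (j <= i).
Proof. by rewrite leqNgt ltn_rev_ord -leqNgt. Qed.

Lemma exc_antiflip s : exc (antiflip s) = exc s.
Proof.
rewrite /exc -!sum1dep_card (reindex_inj (@rev_ord_perm_inj s)).
by apply: eq_bigl => i; rewrite antiflipE ltn_rev_ord.
Qed.

(** The reflection swaps the two members of a pair and preserves each kind of crossing. *)
Lemma crs_antiflip s : crs (antiflip s) = crs s.
Proof.
have inj : injective (fun ij : 'I_n * 'I_n => (rev_ord (s ij.2), rev_ord (s ij.1))).
  move=> [i j] [i' j'] e.
  have /rev_ord_perm_inj/= -> := congr1 fst e.
  by have /rev_ord_perm_inj/= -> := congr1 snd e.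
rewrite /crs -!sum1dep_card (reindex_inj inj).
apply: eq_bigl => -[i j]; rewrite /crossing !antiflipE !ltn_rev_ord !leq_rev_ord /=.
by congr (_ || _); rewrite andbCA andbA andbC andbA.
Qed.

Lemma avoids132_antiflip s : avoids132 (word (antiflip s))
  = triplewise (fun a b c => ~~ same_order 2 1 3 a b c) (word s).
Proof.
apply/triplewise_wordP/triplewise_wordP => av i j k ij jk; apply/negP.
  (* A 213 at [i < j < k] becomes a 132 at the images of [k], [i], [j], in this order. *)
  move=> occ; have := av (rev_ord (s k)) (rev_ord (s i)) (rev_ord (s j)).
  rewrite !ltn_rev_ord !antiflipE /same_order !ltn_rev_ord.
  have ne : s i != s j :> nat by rewrite val_eqE (inj_eq perm_inj) -val_eqE neq_ltn ij.
  by move: occ; rewrite /same_order; lia.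
(* Conversely, a 132 at [i < j < k] becomes a 213 at the images of [j], [k], [i]. *)
move=> occ; set t := antiflip s in occ.
have := av (rev_ord (t j)) (rev_ord (t k)) (rev_ord (t i)).
rewrite -(antiflipK s) -/t !ltn_rev_ord !antiflipE /same_order !ltn_rev_ord.
have ne : t j != t k :> nat by rewrite val_eqE (inj_eq perm_inj) -val_eqE neq_ltn jk.
by move: occ; rewrite /same_order; lia.
Qed.

End Antidiagonal.

Lemma sum_avoids213 (R : comNzRingType) (q p : R) n :
  (\sum_(s : 'S_n | triplewise (fun a b c => ~~ same_order 2 1 3 a b c) (word s))
     q ^+ exc s * p ^+ crs s = qpCatalan q p n)%R.
Proof.
rewrite -sum_avoids132 [RHS](reindex_inj (inv_inj (@antiflipK n))) /=.
by apply: eq_big => s; rewrite ?avoids132_antiflip // exc_antiflip crs_antiflip.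
Qed.

Local Open Scope ring_scope.

Theorem theorem5p2 (R : comNzRingType) (q p : R) (n : nat) (tau : 'S_3)
    (Htau : one_line tau \in [:: [:: 2; 1; 3]%N; [:: 1; 3; 2]%N; [:: 3; 2; 1]%N]) :
  \sum_(s in avoiders n tau) q ^+ exc s * p ^+ crs s = qpCatalan q p n.
Proof.
move: Htau; rewrite !inE => /or3P[] /eqP tauE.
- rewrite -[RHS]sum_avoids213; apply: eq_bigl => s.
  exact: avoiders_triplewise tauE.
- rewrite -[RHS]sum_avoids132; apply: eq_bigl => s.
  exact: avoiders_triplewise tauE.
- rewrite -[RHS]sum_avoids321; apply: eq_bigl => s.
  exact: avoiders_triplewise tauE.
Qed.
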